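(* Let $I\subset\mathbb{R}$ be a compact interval and let $f:I\to I$ be a continuous map. Then $(I,f)$ has the approximate product property and zero topological entropy if and only if it has a unique attracting fixed point, i.e. there is $p\in I$ such that $f(p)=p$ and $$\lim_{n\to\infty}f^n(x)=p\quad\text{for every }x\in I.$$
   Context: A system $(X,f)$ is a compact metric space $(X,d)$ with a continuous map $f:X\to X$ (not necessarily invertible); here $X=I$ with the usual distance. $\mathbb{Z}^+$ denotes the set of positive integers, and $\mathbb{Z}_n:=\{0,1,\dots,n-1\}$ for $n\in\mathbb{Z}^+$. Tracing. Let $\mathscr{C}=\{x_k\}_{k\in\mathbb{Z}^+}$ be a sequence in $X$ and let $\mathscr{S}=\{m_k\}_{k\in\mathbb{Z}^+}$, $\mathscr{G}=\{t_k\}_{k\in\mathbb{Z}^+}$ be sequences of positive integers. Put $s_1:=0$ and $s_k:=\sum_{i=1}^{k-1}(m_i+t_i-1)$ for $k\ge 2$. For real $\delta\ge 0$, $\varepsilon>0$ and $z\in X$, the triple $(\mathscr{C},\mathscr{S},\mathscr{G})$ is $(\delta,\varepsilon)$-traced by $z$ if for every $k\in\mathbb{Z}^+$, $$\left|\left\{j\in\mathbb{Z}_{m_k}: d(f^{s_k+j}(z),f^j(x_k))>\varepsilon\right\}\right|\le \delta m_k.$$ Approximate product property. $(X,f)$ has the approximate product property if for all $\delta_1,\delta_2,\varepsilon>0$ there is $M=M(\delta_1,\delta_2,\varepsilon)>0$ such that for every integer $n>M$ and every sequence $\mathscr{C}$ in $X$ there are a sequence $\mathscr{G}=\{t_k\}_{k\in\mathbb{Z}^+}$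 of positive integers with $t_k\le 1+\delta_1 n$ for all $k$ and a point $z\in X$ such that $(\mathscr{C},\{n\}^{\mathbb{Z}^+},\mathscr{G})$ is $(\delta_2,\varepsilon)$-traced by $z$, where $\{n\}^{\mathbb{Z}^+}$ is the constant sequence $n$. *)

(* Defs.v *)
From mathcomp Require Import all_boot all_order all_algebra finmap.
From mathcomp Require Import all_classical all_reals all_analysis.

Set Implicit Arguments.
Unset Strict Implicit.
Unset Printing Implicit Defensive.

Import Order.TTheory GRing.Theory Num.Theory.
Import numFieldNormedType.Exports.

Local Open Scope classical_set_scope.
Local Open Scope ring_scope.

(* A system (X, f) with X a subset of the real line, with the usual distance,
   is encoded by X : set R and a map f : R -> R sending X to itself: every
   point quantified over below is required to lie in X, so that the values of
   f outside X are irrelevant.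
   Sequences indexed by the positive integers are shifted to start at 0. *)
Section Dynamics.
Context {R : realType}.
Implicit Types (X : set R) (f : R -> R).

(* In 1-based notation, trace_start m t k is
   s_(k+1) = \sum_(1 <= i <= k) (m_i + t_i - 1). It is used only for positive
   m and t, for which the truncated subtraction is exact. *)
Definition trace_start (m t : nat -> nat) (k : nat) : nat :=
  (\sum_(i < k) (m i + t i - 1))%N.

Definition traced f (x : nat -> R) (m t : nat -> nat) (delta eps z : R) :=
  forall k : nat,
    #|[pred j : 'I_(m k) |
        eps < `|iter (trace_start m t k + j) f z - iter j f (x k)|]|%:R
    <= delta * (m k)%:R.

Definition approximate_product_property X f :=
  forall delta1 delta2 eps : R, 0 < delta1 -> 0 < delta2 -> 0 < eps ->
  exists2 M : R, 0 < M &
  forall n : nat, M < n%:R ->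
  forall x : nat -> R, (forall k, X (x k)) ->
  exists t : nat -> nat,
    (forall k, (0 < t k)%N /\ (t k)%:R <= 1 + delta1 * n%:R) /\
    exists2 z : R, X z & traced f x (fun=> n) t delta2 eps z.

Definition orbit_separated f (n : nat) (eps : R) (E : {fset R}) :=
  forall x y : R, x \in E -> y \in E -> x != y ->
  exists2 j : nat, (j < n)%N & eps < `|iter j f x - iter j f y|.

Definition max_separated X f (n : nat) (eps : R) : \bar R :=
  ereal_sup [set (#|` E|%:R)%:E |
    E in [set E : {fset R} | [set` E] `<=` X /\ orbit_separated f n eps E]].

(* Bowen's definition, by (n, eps)-separated sets; the value of the sequence
   at n = 0 does not affect the limit superior. *)
Definition topological_entropy X f : \bar R :=
  lim (limn_esup
         (fun n : nat => (n%:R^-1)%:E * lne (max_separated X f n eps))%E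
       @[eps --> (0 : R)^'+]).

End Dynamics.

(* Main.v *)
Require Import Defs.
From mathcomp Require Import all_boot all_order all_algebra finmap.
From mathcomp Require Import all_classical all_reals all_analysis.
From mathcomp Require Import lra zify.

(** If p attracts every point, then p is the only fixed point of f o f. The
    intersection [c, d] of the decreasing intervals f^n(I) is then reduced to p,
    so f^n tends to p uniformly: the point p itself shadows every sequence up to
    a small proportion of times, and (n, eps)-separated sets have bounded
    cardinality. Conversely let f p = p and f (f q) = q with q <> p. The orbits
    of p and q stay apart, and shadowing all concatenations of blocks of these
    two orbits produces exponentially many separated points, so zero entropy
    forces p to be the only fixed point of f o f. *)

Set Implicit Arguments.
Unset Strict Implicit.
Unset Printing Implicit Defensive.

Import Order.TTheory GRing.Theory Num.Theory.
Import numFieldNormedType.Exports.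

Local Open Scope classical_set_scope.
Local Open Scope ring_scope.

(** * Asymptotic core of a continuous self-map of a compact interval *)

Lemma continuous_iter (T : topologicalType) (f : T -> T) (n : nat) :
  continuous f -> continuous (iter n f).
Proof.
move=> fc; elim: n => [|n IHn] x; first exact: cvg_id.
exact: (continuous_comp (IHn x) (fc (iter n f x))).
Qed.

Section UniformConvergence.
Context {R : realType}.
Variables (a b : R) (f : R -> R).
Hypothesis ab : a <= b.
Hypothesis f_itv : forall x, a <= f x <= b.
Hypothesis f_cont : continuous f.

Let fE x : (a <= f x) * (f x <= b).
Proof. by have /andP[-> ->] := f_itv x. Qed.

Lemma fixed_point_between (g : R -> R) (u v : R) : u <= v -> continuous g ->
  u <= g u -> g v <= v -> exists2 r, u <= r <= v & g r = r.
Proof.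
move=> uv gc gu gv.
have hc : {within `[u, v], continuous (fun x => x - g x)}.
  apply: continuous_subspaceT => x.
  apply: cvgB; [exact: cvg_id | exact: gc].
have [|r ruv r0] := IVT uv hc (v := 0).
  by rewrite ge_min le_max; apply/andP; split; apply/orP; [left|right]; lra.
by exists r; [rewrite in_itv in ruv | lra].
Qed.

Lemma continuous_gt_nbhd (g : R -> R) (x k : R) : continuous g -> k < g x ->
  exists2 e, 0 < e & forall y, `|y - x| < e -> k < g y.
Proof.
move=> gc kx.
have : \forall y \near x, k < g y by exact: cvgr_gt (gc x) k kx.
case/nbhs_ballP => e /= e0 be; exists e => // y yx; apply: be.
by rewrite /ball /= distrC.
Qed.

(** The images [f^n([a, b])] decrease with [n], so [sup lower] and [inf upper], called [c] and [d]
    below, are the endpoints of their intersection. *)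
Let lower := [set l | exists n, forall x, a <= x <= b -> l <= iter n f x].
Let upper := [set l | exists n, forall x, a <= x <= b -> iter n f x <= l].

Lemma iter_itv n x : a <= x <= b -> a <= iter n f x <= b.
Proof. by case: n => //= n _. Qed.

Let lowerP : has_sup lower.
Proof.
split; first by exists a, 0%N => x /andP[].
exists b => l [n] /(_ b); rewrite ab lexx => /(_ isT) h.
by apply: le_trans h _; have := @iter_itv n b; rewrite ab lexx => /(_ isT)/andP[].
Qed.

Let upperP : has_inf upper.
Proof.
split; first by exists b, 0%N => x /andP[].
exists a => l [n] /(_ b); rewrite ab lexx => /(_ isT) h.
by apply: le_trans h; have := @iter_itv n b; rewrite ab lexx => /(_ isT)/andP[].
Qed.

(** The point [f^(n+m)(b)] lies in both the [n]-th and the [m]-th image. *)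
Lemma lower_le_upper l u : lower l -> upper u -> l <= u.
Proof.
move=> [n ln] [m um]; have bb : a <= b <= b by rewrite ab lexx.
apply: le_trans (ln _ (iter_itv m bb)) _; rewrite -iterD addnC iterD.
exact: um (iter_itv n bb).
Qed.

Let c := sup lower.
Let d := inf upper.

Let cd : c <= d.
Proof.
apply: ge_sup; first by case: lowerP.
move=> l ll; apply: lb_le_inf; first by case: upperP.
by move=> u uu; exact: lower_le_upper.
Qed.

Let ac : a <= c.
Proof. by apply: ub_le_sup; [case: lowerP | exists 0%N => x /andP[]]. Qed.

Let db : d <= b.
Proof. by apply: ge_inf; [case: upperP | exists 0%N => x /andP[]]. Qed.

(** A bound valid on one image holds on all later ones, which are contained in it. *)
Lemma iter_near_core e : 0 < e ->
  exists N, forall n, (N <= n)%N -> forall x, a <= x <= b ->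
    c - e < iter n f x < d + e.
Proof.
move=> e0.
have [l [n ln] lc] := sup_adherent e0 lowerP.
have [u [m um] ud] := inf_adherent e0 upperP.
exists (n + m)%N => k nmk x xab; apply/andP; split.
  apply: lt_le_trans lc _; rewrite -(@subnKC n k); last by lia.
  by rewrite iterD; apply/ln/iter_itv.
apply: le_lt_trans ud; rewrite -(@subnKC m k); last by lia.
by rewrite iterD; apply/um/iter_itv.
Qed.

(** Otherwise [f > k > c] on [[c, d]], hence near [[c, d]] by continuity. Some [f^N([a, b])] lies
    that near, so [k] bounds the next image from below, against the choice of [c]. *)
Let core_lower : exists2 y, c <= y <= d & f y <= c.
Proof.
have [z zcd zmin] := EVT_min cd (continuous_subspaceT f_cont).
rewrite in_itv /= in zcd; case: (leP (f z) c) => [|cz]; first by exists z.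
pose k := (c + f z) / 2.
have fk x : c <= x <= d -> k < f x.
  by move=> xcd; have := zmin x; rewrite in_itv => /(_ xcd); rewrite /k; lra.
(* Neighbourhoods of the two endpoints suffice: a point of [f^N([a, b])] outside [[c, d]] is within
   [e] of [c] or of [d]. *)
have [e1 e10 he1] := @continuous_gt_nbhd _ c k f_cont (fk c ltac:(by rewrite lexx)).
have [e2 e20 he2] := @continuous_gt_nbhd _ d k f_cont (fk d ltac:(by rewrite lexx andbT)).
pose e := Num.min e1 e2.
have e0 : 0 < e by rewrite lt_min e10.
have [ee1 ee2] : e <= e1 /\ e <= e2 by rewrite !ge_min !lexx orbT.
have [N hN] := iter_near_core e0.
have : lower k.
  exists N.+1 => x xab; rewrite iterS.
  have /andP[h1 h2] := hN N (leqnn _) x xab.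
  case: (leP c (iter N f x)) => h3; last first.
    by apply/ltW/he1; rewrite ltr_norml; apply/andP; split; lra.
  case: (leP (iter N f x) d) => h4; first by apply/ltW/fk; rewrite h3.
  by apply/ltW/he2; rewrite ltr_norml; apply/andP; split; lra.
move/(ub_le_sup (proj2 lowerP)); rewrite -/c => kc.
by exfalso; move: kc cz; rewrite /k; lra.
Qed.

Let core_upper : exists2 x, c <= x <= d & d <= f x.
Proof.
have [z zcd zmax] := EVT_max cd (continuous_subspaceT f_cont).
rewrite in_itv /= in zcd; case: (leP d (f z)) => [|zd]; first by exists z.
pose k := (d + f z) / 2; pose g x := - f x.
have gc : continuous g by move=> x; apply: cvgN; exact: f_cont.
have gk x : c <= x <= d -> - k < g x.
  by move=> xcd; have := zmax x; rewrite in_itv => /(_ xcd); rewrite /k /g; lra.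
have [e1 e10 he1] := continuous_gt_nbhd gc (gk c ltac:(by rewrite lexx)).
have [e2 e20 he2] := continuous_gt_nbhd gc (gk d ltac:(by rewrite lexx andbT)).
pose e := Num.min e1 e2.
have e0 : 0 < e by rewrite lt_min e10.
have [ee1 ee2] : e <= e1 /\ e <= e2 by rewrite !ge_min !lexx orbT.
have [N hN] := iter_near_core e0.
have : upper k.
  exists N.+1 => x xab; rewrite iterS -lerN2.
  have /andP[h1 h2] := hN N (leqnn _) x xab.
  case: (leP c (iter N f x)) => h3; last first.
    by apply/ltW/he1; rewrite ltr_norml; apply/andP; split; lra.
  case: (leP (iter N f x) d) => h4; first by apply/ltW/gk; rewrite h3.
  by apply/ltW/he2; rewrite ltr_norml; apply/andP; split; lra.
move/(ge_inf (proj2 upperP)); rewrite -/d => kd.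
by exfalso; move: kd zd; rewrite /k; lra.
Qed.

Variable p : R.
Hypothesis p_itv : a <= p <= b.
Hypothesis f_fix : f p = p.
Hypothesis f2_fix : forall q, a <= q <= b -> f (f q) = q -> q = p.

(** If [f x <= x], then [a <= f a] gives a fixed point in [[a, x]]; it is also fixed by [f o f],
    hence equals [p], although [x < p]. *)
Let lt_f x : a <= x -> x < p -> x < f x.
Proof.
move=> ax xp; rewrite ltNge; apply/negP => fx.
have [r /andP[ar rx] fr] := fixed_point_between ax f_cont (fE a).1 fx.
have : r = p by apply: f2_fix; rewrite ?fr //; case/andP: p_itv; lra.
by move=> rp; lra.
Qed.

Let gt_f x : x <= b -> p < x -> f x < x.
Proof.
move=> xb px; rewrite ltNge; apply/negP => fx.
have [r /andP[xr rb] fr] := fixed_point_between xb f_cont fx (fE b).2.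
have : r = p by apply: f2_fix; rewrite ?fr //; case/andP: p_itv; lra.
by move=> rp; lra.
Qed.

(* Points of [c, d] mapped below c and above d lie on opposite sides of p;
   f o f then has a fixed point on the right of p. *)
Let core_trivial : c = p /\ d = p.
Proof.
have [y /andP[cy yd] fy] := core_lower.
have [x /andP[cx xd] fx] := core_upper.
have h1 := ac; have h2 := db; have h3 := cd.
(* If [y = p], then [p <= c], so [c = p]; a point [x > p] cannot be sent above [d], since
   [f x < x <= d]. *)
have [ey|yp] := eqVneq y p.
  rewrite ey f_fix in cy fy.
  have [ex|xp] := eqVneq x p; first by rewrite ex f_fix in fx; split; lra.
  have xgt : p < x by rewrite lt_neqAle eq_sym xp; lra.
  by have := @gt_f x; lra.
have ygt : p < y.
  by rewrite lt_neqAle eq_sym yp leNgt; apply/negP => ylt; have := @lt_f y; lra.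
have xlt : x < p.
  rewrite ltNge; apply/negP => xge.
  have [ex|xp] := eqVneq x p; first by rewrite ex f_fix in fx; lra.
  have xgt : p < x by rewrite lt_neqAle eq_sym xp.
  by have := @gt_f x; lra.
(* [f] equals [p] at [p] and is at most [c <= x] at [y], so it takes the value [x] in between. Then
   [f (f y') = f x >= d >= y'], which starts the search for a fixed point of [f o f] in
   [[y', b]]. *)
have [y' y'py fy'] : exists2 y', y' \in `[p, y] & f y' = x.
  apply: IVT; [exact: ltW | exact: continuous_subspaceT |].
  by rewrite f_fix ge_min le_max; apply/andP; split; apply/orP; [right|left]; lra.
rewrite in_itv /= in y'py; case/andP: y'py => py' y'y.
have y'b : y' <= b by lra.
have f2c : continuous (f \o f) by exact: (@continuous_iter _ f 2 f_cont).
have y'2 : y' <= (f \o f) y' by rewrite /= fy'; lra.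
have [r rr fr] := fixed_point_between y'b f2c y'2 (fE _).2.
have rp : r = p by apply: f2_fix => //; case/andP: rr; case/andP: p_itv; lra.
have y'p : y' = p by apply/eqP; rewrite eq_le py' andbT -rp; case/andP: rr.
by move: fy'; rewrite y'p f_fix; lra.
Qed.

Lemma uniform_cvg_of_square_fixed e : 0 < e ->
  exists N, forall n, (N <= n)%N -> forall x, a <= x <= b ->
    `|iter n f x - p| < e.
Proof.
move=> e0; have [N hN] := iter_near_core e0; exists N => n Nn x xab.
have [cp dp] := core_trivial; have := hN n Nn x xab.
by rewrite cp dp ltr_norml; lra.
Qed.

End UniformConvergence.

(** * Consequences of uniform convergence to a fixed point *)

Lemma card_ord_le (n N : nat) (P : pred 'I_n) :
  (forall j, P j -> (j < N)%N) -> (#|P| <= N)%N.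
Proof.
move=> PN; rewrite cardE -(size_map val) -[leqRHS](size_iota 0).
apply: uniq_leq_size; first by rewrite (map_inj_uniq val_inj) enum_uniq.
by move=> _ /mapP[j + ->]; rewrite mem_enum mem_iota => /PN.
Qed.

Section UniformAttraction.
Context {R : realType}.
Variables (X : set R) (f : R -> R) (p : R).
Hypothesis Xp : X p.
Hypothesis p_unif : forall e, 0 < e ->
  exists N, forall n, (N <= n)%N -> forall x, X x -> `|iter n f x - p| < e.

(** The point [p] traces every sequence with all gaps equal to 1: in each block only the first [N]
    times can be bad, a small share of a long block. *)
Lemma approximate_product_property_uniform :
  f p = p -> approximate_product_property X f.
Proof.
move=> fp d1 d2 e d10 d20 e0.
have [N hN] := p_unif e0.
(* The quotient ensures [N <= d2 * n]; adding 1 keeps the threshold positive when [N = 0]. *)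
exists (N%:R / d2 + 1); first by rewrite ltr_wpDl// divr_ge0// ltW.
move=> n nM x Xx; exists (fun=> 1%N); split=> [k|].
  by split=> //; rewrite lerDl mulr_ge0// ltW.
exists p => // k; set P := (X in #|X|).
have : (#|P| <= N)%N.
  apply: card_ord_le => j; rewrite /P /= iter_fix// ltNge => h.
  rewrite ltnNge; apply/negP => Nj; case/negP: h; apply: ltW.
  by rewrite distrC; exact: hN.
rewrite -(ler_nat R) => /le_trans; apply.
rewrite mulrC -ler_pdivrMr//; apply: ltW; apply: lt_trans nM.
by rewrite ltrDl.
Qed.

Hypothesis X_compact : compact X.
Hypothesis iter_cont : forall n x, X x -> forall e, 0 < e ->
  exists2 d, 0 < d & forall y, X y -> `|y - x| < d ->
    `|iter n f y - iter n f x| < e.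

Lemma iter_equicontinuous n x e : X x -> 0 < e ->
  exists2 d, 0 < d & forall y, X y -> `|y - x| < d ->
    forall j, (j < n)%N -> `|iter j f y - iter j f x| < e.
Proof.
move=> Xx e0; elim: n => [|n [d d0 IH]]; first by exists 1.
have [d' d'0 IH'] := iter_cont n Xx e0.
exists (Num.min d d'); first by rewrite lt_min d0.
move=> y Xy; rewrite lt_min => /andP[yd yd'] j.
by rewrite ltnS leq_eqVlt => /orP[/eqP->|jn]; [exact: IH' | exact: IH].
Qed.

(** By compactness, finitely many balls cover [X] on which the first [n] iterates stay within
    [e / 2] of those of the centre. A separated set has at most one point assigned to each
    centre. *)
Lemma separated_card_bound n e : 0 < e ->
  exists C, forall E : {fset R}, [set` E] `<=` X -> orbit_separated f n e E ->
    (#|` E| <= C)%N.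
Proof.
move=> e0; have e20 : 0 < e / 2 by rewrite divr_gt0.
have /choice[r hr] : forall x, exists r, 0 < r /\ (X x -> forall y, X y ->
    `|y - x| < r -> forall j, (j < n)%N -> `|iter j f y - iter j f x| < e / 2).
  move=> x; have [Xx|nXx] := pselect (X x); last by exists 1.
  by have [d d0 hd] := iter_equicontinuous n Xx e20; exists d.
move: X_compact; rewrite compact_cover => /(_ R X (fun x => ball x (r x))).
case.
- by move=> x Xx; apply: ball_open; exact: (hr x).1.
- by move=> x Xx; exists x => //; apply: ballxx; exact: (hr x).1.
move=> D DX Dcov; exists #|` D| => E EX Esep.
have /choice[c hc] : forall y, exists c, X y -> c \in D /\ ball c (r c) y.
  move=> y; have [Xy|nXy] := pselect (X y); last by exists 0.
  by have [c cD yc] := Dcov y Xy; exists c.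
have c_inj : {in E &, injective c}.
  move=> y z yE zE cyz; apply/eqP/negPn/negP => yz.
  have [j jn] := Esep y z yE zE yz; apply/negP; rewrite -leNgt.
  have [/DX + hy] := hc y (EX _ yE); rewrite inE => Xc.
  have [_ hz] := hc z (EX _ zE); rewrite -cyz in hz.
  have h1 := (hr (c y)).2 Xc y (EX _ yE) _ j jn.
  have h2 := (hr (c y)).2 Xc z (EX _ zE) _ j jn.
  rewrite /ball /= distrC in hy; rewrite /ball /= distrC in hz.
  move: (h1 hy) (h2 hz); rewrite !ltr_norml ler_norml.
  by move=> /andP[? ?] /andP[? ?]; apply/andP; split; lra.
rewrite -(card_in_imfset imfset_key c_inj); apply: fsubset_leq_card.
apply/fsubsetP => _ /imfsetP[y yE ->].
exact: (hc y (EX _ yE)).1.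
Qed.

Lemma max_separated_ge1 n e : (1 <= max_separated X f n e)%E.
Proof.
apply: ereal_sup_ubound; exists [fset p]%fset; last by rewrite cardfs1.
split=> [x|x y]; rewrite /= ?inE; first by move/eqP->.
by move=> /eqP-> /eqP->; rewrite eqxx.
Qed.

(** From time [N] on, all orbits are within [e / 2] of [p], so any separation happens before [N],
    and the bound for [N] serves every [n]. *)
Lemma max_separated_bounded e : 0 < e ->
  exists2 C : R, 1 <= C & forall n, (max_separated X f n e <= C%:E)%E.
Proof.
move=> e0; have e20 : 0 < e / 2 by rewrite divr_gt0.
have [N hN] := p_unif e20.
have [C hC] := separated_card_bound N e0.
exists C.+1%:R; first by rewrite ler1n.
move=> n; apply: ge_ereal_sup => _ [E [EX Esep] <-].
rewrite lee_fin ler_nat; apply: leqW; apply: hC => // x y xE yE xy.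
have [j _ ej] := Esep x y xE yE xy; exists j => //.
rewrite ltnNge; apply/negP => Nj.
have h1 := hN j Nj x (EX _ xE); have h2 := hN j Nj y (EX _ yE).
move: ej; apply/negP; rewrite -leNgt ler_norml.
move: h1 h2; rewrite !ltr_norml => /andP[? ?] /andP[? ?].
by apply/andP; split; lra.
Qed.

Lemma cvg_natV_mul (r : R) : (fun n => n%:R^-1 * r) n @[n --> \oo] --> (0 : R).
Proof.
rewrite -[X in _ --> X](mul0r r); apply: cvgMl.
by rewrite -cvg_shiftS; exact: cvg_harmonic.
Qed.

(** At each scale the separated sets have bounded size, so the logarithm divided by [n] is squeezed
    to 0. *)
Lemma topological_entropy_uniform : topological_entropy X f = 0%E.
Proof.
apply: cvg_lim => //; apply: cvg_near_cst.
near=> e.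
have e0 : 0 < e by near: e; exact: nbhs_right_gt.
have [C C1 hC] := max_separated_bounded e0.
apply: (cvg_limn_einf_sup _).2.
apply: (@squeeze_cvge _ _ _ _ (fun=> 0%E) _ (fun n => (n%:R^-1 * ln C)%:E)).
- apply: nearW => n; rewrite EFinM; apply/andP; split.
    apply: mule_ge0; first by rewrite lee_fin invr_ge0.
    by rewrite lne_ge0 max_separated_ge1.
  apply: lee_wpmul2l; first by rewrite lee_fin invr_ge0.
  have C0 : 0 < C by apply: lt_le_trans C1.
  rewrite -lne_EFin// lee_lne ?hC//; rewrite in_itv /= leey andbT.
    exact: le_trans (max_separated_ge1 n e).
  by rewrite lee_fin ltW.
- exact: cvg_cst.
- by apply: cvg_EFin; [exact: nearW | exact: cvg_natV_mul].
Unshelve. all: by end_near.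
Qed.

End UniformAttraction.

(** * Counting in overlapping windows, and pigeonhole *)

Lemma count_overlap (n r : nat) (P Q : pred nat) :
  (count P (iota 0 n) + count Q (iota 0 n) + r < n)%N ->
  exists2 j, (r + j < n)%N & ~~ P (r + j)%N /\ ~~ Q j.
Proof.
move=> h; apply: contrapT => noj.
(* Two windows of length [n], the second starting [r] later, share [n - r] times. Were each of these
   bad for [P] or [Q], the two counts would add up to at least [n - r]. *)
have : all (predU (P \o addn r) Q) (iota 0 (n - r)).
  apply/allP => j; rewrite mem_iota /= => jn.
  apply/negPn/negP; rewrite negb_or => PQj.
  by apply: noj; exists j; [lia | exact/andP].
rewrite all_count size_iota => /eqP all_bad.
have := count_predUI (P \o addn r) Q (iota 0 (n - r)).
rewrite all_bad -count_map -iotaDl addn0.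
have nE : n = (r + (n - r))%N by lia.
have := count_cat P (iota 0 r) (iota r (n - r)).
have := count_cat Q (iota 0 (n - r)) (iota (n - r) r).
by rewrite -(iotaD 0 r) -(iotaD 0 (n - r)) subnK -?nE; lia.
Qed.

Lemma card_pigeonhole (S T : finType) (g : S -> T) (k : nat) :
  (#|T| * k < #|S|)%N -> exists y, (k < #|[pred x | g x == y]|)%N.
Proof.
move=> kS; apply: contrapT => noy; move: kS; apply/negP; rewrite -leqNgt.
rewrite -sum1_card (partition_big g predT) //= -sum_nat_const.
apply: leq_sum => y _; rewrite sum1_card leqNgt; apply/negP => ky.
by apply: noy; exists y.
Qed.

(** * Coarse records of accumulated gaps *)

Section Drift.
Variables (m h : nat) (u : {ffun 'I_m.*2 -> bool} -> nat -> nat).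
Hypothesis h_gt0 : (0 < h)%N.
Hypothesis u0 : forall w, u w 0 = 0.
Hypothesis u_step : forall w k, (u w k <= u w k.+1 <= u w k + h)%N.

(** Two blocks drift by at most [2h], so this quotient rises by 0 or 1 at each step; [code] stores
    these increments. *)
Let quot w i := (u w i.*2 %/ h.*2)%N.
Let code w := [ffun i : 'I_m => (quot w i < quot w i.+1)%N].

Let quotS w i : quot w i.+1 = (quot w i + (quot w i < quot w i.+1))%N.
Proof.
rewrite /quot doubleS; set a := u w i.*2; set b := u w i.*2.+2.
have /andP[a1 a2] := u_step w i.*2; have /andP[b1 b2] := u_step w i.*2.+1.
have ab : (a %/ h.*2 <= b %/ h.*2)%N by apply: leq_div2r; lia.
have ba : (b %/ h.*2 <= (a + h.*2) %/ h.*2)%N by apply: leq_div2r; lia.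
rewrite divnDr ?dvdnn// divnn double_gt0 h_gt0 in ba.
by case: ltnP => ?; move: ab ba; lia.
Qed.

Let code_quot w w' i : code w = code w' -> (i <= m)%N -> quot w i = quot w' i.
Proof.
move=> ww'; elim: i => [_|i IH im]; first by rewrite /quot !u0.
rewrite quotS (quotS w') IH ?(ltnW im)//; congr (_ + nat_of_bool _)%N.
by have /ffunP/(_ (Ordinal im)) := ww'; rewrite !ffunE /= IH ?(ltnW im).
Qed.

(* Recording the drift u once every two blocks, at scale 2h, costs one bit:
   there are 4^m patterns and only 2^m records. *)
Lemma many_patterns_same_drift : exists A : pred {ffun 'I_m.*2 -> bool},
  (2 ^ m <= #|A|)%N /\
  forall w w', A w -> A w' -> forall k, (k < m.*2)%N ->
    (u w k < u w' k + 3 * h)%N.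
Proof.
(* The pigeonhole inequalities are strict, so [2 ^ m - 1] yields a fibre of at least [2 ^ m]
   patterns. *)
have [|y hy] := @card_pigeonhole _ _ code (2 ^ m).-1.
  rewrite !card_ffun !card_bool !card_ord -addnn expnD ltn_pmul2l ?expn_gt0//.
  by rewrite prednK ?expn_gt0.
exists [pred w | code w == y]; split; first by move: hy; rewrite prednK ?expn_gt0.
move=> w w' /eqP wy /eqP w'y k km.
have im : (k./2 <= m)%N by lia.
have qq := code_quot (etrans wy (esym w'y)) im.
have hk : k = k./2.*2 \/ k = k./2.*2.+1 by lia.
(* Equal quotients put the drifts at even indices within [2h]; an odd [k] costs at most [h] more,
   whence [3h]. *)
have lt2 : (u w k./2.*2 < u w' k./2.*2 + h.*2)%N.
  have := ltn_ceil (u w k./2.*2) (d := h.*2); rewrite double_gt0 => /(_ h_gt0).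
  have := leq_trunc_div (u w' k./2.*2) h.*2; rewrite -/(quot _ _) -/(quot _ _) qq.
  by rewrite mulSn; lia.
have /andP[_ s1] := u_step w k./2.*2; have /andP[s2 _] := u_step w' k./2.*2.
by case: hk => ->; rewrite ?doubleK /=; lia.
Qed.

End Drift.

(** * Tracing points, separation and lower bounds for entropy *)

Lemma trace_startS (m t : nat -> nat) (k : nat) :
  trace_start m t k.+1 = (trace_start m t k + (m k + t k - 1))%N.
Proof. by rewrite /trace_start big_ord_recr. Qed.

Lemma trace_start_cst (n : nat) (t : nat -> nat) (k : nat) :
    (forall i, (0 < t i)%N) ->
  trace_start (fun=> n) t k = (k * n + \sum_(i < k) (t i).-1)%N.
Proof.
move=> t0; elim: k => [|k IH]; first by rewrite /trace_start !big_ord0.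
by rewrite trace_startS IH big_ord_recr /=; have := t0 k; lia.
Qed.

Section Separation.
Context {R : realType}.
Variable f : R -> R.

Lemma traced_count (n : nat) (x : nat -> R) (t : nat -> nat) (d e z : R) k :
    traced f x (fun=> n) t d e z ->
  (count (fun j => e < `|iter (trace_start (fun=> n) t k + j) f z -
                         iter j f (x k)|) (iota 0 n))%:R <= d * n%:R.
Proof.
move=> /(_ k); congr (_%:R <= _).
have -> : iota 0 n = index_iota 0 n by rewrite /index_iota subn0.
by rewrite -sum1_card -sum1_count big_mkord.
Qed.

(** Each block of length [16h] has at most [4h] bad times, and [4h + 4h + 3h < 16h] leaves a common
    time good for both points. There each is [e]-close to its reference orbit, and these are more
    than [3e] apart. All pairs [i], [j] are considered because the blocks may be misaligned. *)
Lemma traced_separated (h : nat) (e z z' : R) (x x' : nat -> R)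
    (t t' : nat -> nat) (k : nat) :
    (0 < h)%N ->
    traced f x (fun=> 16 * h)%N t 4^-1 e z ->
    traced f x' (fun=> 16 * h)%N t' 4^-1 e z' ->
    (forall i j, 3 * e < `|iter i f (x k) - iter j f (x' k)|) ->
    (trace_start (fun=> 16 * h)%N t k <
      trace_start (fun=> 16 * h)%N t' k + 3 * h)%N ->
    (trace_start (fun=> 16 * h)%N t' k <
      trace_start (fun=> 16 * h)%N t k + 3 * h)%N ->
  exists2 i, (i < trace_start (fun=> 16 * h)%N t k + 16 * h)%N /\
             (i < trace_start (fun=> 16 * h)%N t' k + 16 * h)%N &
    e < `|iter i f z - iter i f z'|.
Proof.
move=> h0.
wlog tt' : z z' x x' t t' / (trace_start (fun=> 16 * h)%N t k <=
                             trace_start (fun=> 16 * h)%N t' k)%N.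
  move=> wl tz tz' xx' h1 h2.
  have [le_tt'|lt_tt'] := leqP (trace_start (fun=> 16 * h)%N t k)
                               (trace_start (fun=> 16 * h)%N t' k).
    exact: (wl z z' x x' t t').
  have [|i [i1 i2] ei] := wl _ _ _ _ _ _ (ltnW lt_tt') tz' tz _ h2 h1.
    by move=> i j; rewrite distrC.
  by exists i => //; rewrite distrC.
move=> tz tz' xx' _; set s := trace_start _ t k in tt' *.
set s' := trace_start _ t' k in tt' * => s's.
have := traced_count k tz'; have := traced_count k tz.
rewrite -/s -/s'; set P := (fun j => _); set Q := (fun j => _) => hP hQ.
have cP : (count P (iota 0 (16 * h)) <= 4 * h)%N.
  by rewrite -(ler_nat R); move: hP; rewrite !natrM; lra.
have cQ : (count Q (iota 0 (16 * h)) <= 4 * h)%N.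
  by rewrite -(ler_nat R); move: hQ; rewrite !natrM; lra.
have [|j jn [Pj Qj]] := @count_overlap (16 * h) (s' - s) P Q; first by lia.
exists (s' + j)%N; first by lia.
move: Pj Qj; rewrite /P /Q -!leNgt (_ : s + (s' - s + j) = s' + j)%N; last by lia.
have := xx' (s' - s + j)%N j.
move: (iter _ f (x k)) (iter _ f (x' k)) (iter _ f z) (iter _ f z').
move=> y y' v v' yy' vy v'y'; rewrite ltNge; apply/negP => vv'.
move: yy'; apply/negP; rewrite -leNgt.
move: vy v'y' vv'; rewrite !ler_norml => /andP[? ?] /andP[? ?] /andP[? ?].
by apply/andP; split; lra.
Qed.

Lemma max_separated_antitone (X : set R) (n : nat) (e e' : R) : e <= e' ->
  (max_separated X f n e' <= max_separated X f n e)%E.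
Proof.
move=> ee'; apply: ereal_sup_le => _ [E [EX Esep] <-]; exists E => //.
split=> // x y xE yE xy; have [j jn ej] := Esep x y xE yE xy.
by exists j => //; exact: le_lt_trans ej.
Qed.

Lemma limn_esup_le (u v : nat -> \bar R) :
  (forall n, u n <= v n)%E -> (limn_esup u <= limn_esup v)%E.
Proof.
move=> uv; rewrite !limn_esup_lim; apply: lee_lim; [exact: is_cvg_esups..|].
apply: nearW => n; apply: ge_ereal_sup => _ [i ni <-].
by apply: (le_trans (uv i)); apply: ereal_sup_ubound; exists i.
Qed.

Lemma limn_esup_ge_frequently (u : nat -> \bar R) (l : \bar R) :
  (forall n, exists2 i, (n <= i)%N & (l <= u i)%E) -> (l <= limn_esup u)%E.
Proof.
move=> ul; rewrite limn_esup_lim; apply: lime_ge; first exact: is_cvg_esups.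
apply: nearW => n; have [i ni lu] := ul n; apply: (le_trans lu).
by apply: ereal_sup_ubound; exists i.
Qed.

(** Separated sets only grow as the scale shrinks, so exponential growth at the single scale [e],
    along multiples of [N], bounds the limit from below. *)
Lemma topological_entropy_ge (X : set R) (p e r : R) (N : nat) :
    X p -> 0 < e -> 1 <= r -> (0 < N)%N ->
    (forall m, ((r ^+ m)%:E <= max_separated X f (m * N) e)%E) ->
  ((ln r / N%:R)%:E <= topological_entropy X f)%E.
Proof.
move=> Xp e0 r1 N0 sep; have r0 : 0 < r by apply: lt_le_trans r1.
have ge0 n e' : (0 <= max_separated X f n e')%E.
  exact: le_trans (max_separated_ge1 f Xp n e').
have le_lne_sep n (e1 e2 : R) : e1 <= e2 ->
    ((n%:R^-1)%:E * lne (max_separated X f n e2) <=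
     (n%:R^-1)%:E * lne (max_separated X f n e1))%E.
  move=> e12; apply: lee_wpmul2l; first by rewrite lee_fin invr_ge0.
  by rewrite lee_lne ?in_itv /= ?leey ?andbT// max_separated_antitone.
(* The limit over scales exists by monotonicity. *)
apply: lime_ge.
  apply: nonincreasing_at_right_is_cvge; apply: nearW => y e1 e2 _ _ e12.
  by apply: limn_esup_le => n; exact: le_lne_sep.
near=> e'.
have ee' : e' <= e by near: e'; exact: nbhs_right_le.
apply: limn_esup_ge_frequently => n; exists (n.+1 * N)%N; first by nia.
apply: le_trans (le_lne_sep _ _ _ ee').
have -> : ((ln r / N%:R)%:E = ((n.+1 * N)%:R^-1)%:E * lne (r ^+ n.+1)%:E)%E.
  rewrite lne_EFin ?exprn_gt0// lnXn// -EFinM natrM -[ln r *+ _]mulr_natl; congr (_%:E).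
  by rewrite invfM mulrACA mulVf ?mul1r ?pnatr_eq0// mulrC.
apply: lee_wpmul2l; first by rewrite lee_fin invr_ge0.
by rewrite lee_lne ?sep// in_itv /= leey andbT ?ge0// lee_fin exprn_ge0// ltW.
Unshelve. all: by end_near.
Qed.

End Separation.

(** * Positive entropy from a second fixed point of [f o f] *)

Lemma iter_period2 (T : Type) (f : T -> T) (q : T) (n : nat) :
  f (f q) = q -> iter n f q = if odd n then f q else q.
Proof. by move=> ffq; elim: n => //= n ->; case: (odd n). Qed.

(* Shadowing the 4^m concatenations of 2m blocks lying in {p} or {q, f q},
   those with similar gap lengths give 2^m separated points. *)
Lemma topological_entropy_gt0 (R : realType) (X : set R) (f : R -> R)
    (p q : R) :
    approximate_product_property X f ->
    X p -> X q -> f p = p -> f (f q) = q -> q <> p ->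
  (0 < topological_entropy X f)%E.
Proof.
move=> app Xp Xq fp ffq qp.
pose d := Num.min `|p - q| `|p - f q|.
have d0 : 0 < d.
  rewrite lt_min !normr_gt0 !subr_eq0; apply/andP; split; apply/eqP => pq.
    exact: qp.
  (* If [f q = p], then [q = f (f q) = f p = p]. *)
  by apply: qp; rewrite -ffq -pq.
pose e := d / 4; have e0 : 0 < e by rewrite divr_gt0.
have far i j : 3 * e < `|iter i f p - iter j f q|.
  have de : 3 * e < d by rewrite /e; lra.
  apply: (lt_le_trans de); rewrite iter_fix// iter_period2// /d.
  by case: odd; rewrite ge_min lexx ?orbT.
(* With blocks of length [16h], the ratio 1/16 allows gaps [t k <= 1 + h], so a drift of at most [h]
   per block. *)
have [||M M0 hM] := app 16^-1 4^-1 e _ _ e0; [by rewrite invr_gt0..|].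
pose h := (Num.truncn M).+1.
have Mh : M < (16 * h)%N%:R.
  apply: lt_trans (truncnS_gt M) _; rewrite ltr_nat /h.
  by move: (Num.truncn M) => k; lia.
(* A block with its gap takes at most [17h] steps; the [2m] blocks take at most [m * 34h] and yield
   [2 ^ m] points. *)
apply: lt_le_trans (topological_entropy_ge (r := 2) (N := (34 * h)%N) Xp e0 _ _ _).
- by rewrite lte_fin divr_gt0 ?ln_gt0 ?ltr0n ?ltr1n// muln_gt0.
- by rewrite ler1n.
- by rewrite muln_gt0.
move=> m; pose W := {ffun 'I_m.*2 -> bool}.
(* Beyond the [2m] blocks coded by [w] the sequence is continued by the default [p]. *)
pose x (w : W) k := if odflt true (omap w (insub k)) then p else q.
have /choice[tz htz] : forall w, exists tz : (nat -> nat) * R,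
    [/\ forall k, (0 < tz.1 k)%N /\ ((tz.1 k).-1 <= h)%N, X tz.2 &
        traced f (x w) (fun=> 16 * h)%N tz.1 4^-1 e tz.2].
  move=> w; have [|t [tP [z Xz tz]]] := hM _ Mh (x w).
    by move=> k; rewrite /x; case: ifP.
  exists (t, z); split=> //= k; have [tk tkh] := tP k; split=> //.
  suff : (t k <= 1 + h)%N by lia.
  by rewrite -(ler_nat R) natrD; move: tkh; rewrite natrM; lra.
pose u w k := (\sum_(i < k) ((tz w).1 i).-1)%N.
have [||w k|A [cardA hA]] := @many_patterns_same_drift m h u.
- by [].
- by move=> w; rewrite /u big_ord0.
- rewrite /u big_ord_recr /=; have [/(_ k)[]] := htz w; lia.
have startE w k : trace_start (fun=> 16 * h)%N (tz w).1 k = (k * (16 * h) + u w k)%N.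
  by rewrite trace_start_cst// => i; have [/(_ i)[]] := htz w.
have uh w k : (u w k <= k * h)%N.
  elim: k => [|k IH]; first by rewrite /u big_ord0.
  by rewrite /u big_ord_recr -/(u w k) /= mulSn; have [/(_ k)[]] := htz w; lia.
have sep w w' : A w -> A w' -> w != w' -> exists2 i, (i < m * (34 * h))%N &
    e < `|iter i f (tz w).2 - iter i f (tz w').2|.
  move=> Aw Aw' ww'.
  have [k wk] : exists k, w k != w' k.
    apply: contrapT => nok; move/eqP: ww'; apply; apply/ffunP => k.
    by apply/eqP/negPn/negP => wk; apply: nok; exists k.
  have [_ _ tw] := htz w; have [_ _ tw'] := htz w'.
  have [|||i [iw _] ei] := traced_separated (k := k) (isT : 0 < h)%N tw tw'.
  - move=> i j; rewrite /x !valK /=; move: wk.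
    by case: (w k) (w' k) => -[]// _; rewrite ?far// distrC far.
  - by rewrite !startE; have := hA w w' Aw Aw' k (ltn_ord k); lia.
  - by rewrite !startE; have := hA w' w Aw' Aw k (ltn_ord k); lia.
  exists i => //; move: iw; rewrite startE.
  by have := uh w k; have := ltn_ord k; nia.
pose E := [fset (tz w).2 | w in A]%fset.
(* Separated points are distinct, so no pattern of [A] is lost in [E]. *)
have inj : {in A &, injective (fun w => (tz w).2)}.
  move=> w w' Aw Aw' zz; apply/eqP/negPn/negP => ww'.
  have [i _] := sep w w' Aw Aw' ww'.
  by rewrite zz subrr normr0 ltNge (ltW e0).
have -> : (2 ^+ m = (2 ^ m)%:R :> R) by rewrite natrX.
apply: (@le_trans _ _ (#|` E|%:R)%:E).
  by rewrite lee_fin ler_nat card_in_imfset//= -cardE.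
apply: ereal_sup_ubound; exists E => //; split.
  by move=> _ /imfsetP[w _ ->]; have [] := htz w.
move=> _ _ /imfsetP[w Aw ->] /imfsetP[w' Aw' ->] zz.
by apply: sep => //; apply: contra_neq zz => ->.
Qed.

(** * Extension of an interval map to the real line *)

Section Clamp.
Context {R : realType}.
Variables (a b : R) (f : R -> R).
Hypothesis ab : a <= b.

(** The retraction of the line onto [[a, b]]: composing with it turns continuity within [[a, b]]
    into continuity everywhere, without changing orbits in [[a, b]]. *)
Definition clamp (x : R) : R := Num.max a (Num.min x b).

Lemma clamp_itv x : a <= clamp x <= b.
Proof. by rewrite /clamp le_max lexx /= ge_max ab ge_min lexx orbT. Qed.

Lemma clamp_id x : a <= x <= b -> clamp x = x.
Proof. by move=> /andP[ax xb]; rewrite /clamp min_l// max_r. Qed.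

Lemma clamp_lipschitz x y : `|clamp y - clamp x| <= `|y - x|.
Proof.
have h1 := ler_norm (y - x); have h2 := ler_norm (x - y); rewrite distrC in h2.
rewrite ler_norml /clamp.
case: (leP x b) => ?; case: (leP y b) => ?; case: (leP a x) => ?;
  by case: (leP a y) => ?; case: (leP a b) => ?; apply/andP; split; lra.
Qed.

Lemma continuous_clamp : {within `[a, b], continuous f} ->
  continuous (f \o clamp).
Proof.
move=> fc x; apply/cvgrPdist_lt => e e0.
have /subspace_continuousP/(_ (clamp x)) := fc.
rewrite /= in_itv /= clamp_itv => /(_ isT)/cvgrPdist_lt/(_ e e0).
case/nbhs_ballP => d /= d0 hd; apply/nbhs_ballP; exists d => //= y xy.
apply: hd; last by rewrite /= in_itv /= clamp_itv.
by rewrite /ball /= distrC; apply: le_lt_trans (clamp_lipschitz x y) _; rewrite distrC.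
Qed.

Lemma iter_clamp n x : (forall y, a <= y <= b -> a <= f y <= b) ->
  a <= x <= b -> iter n (f \o clamp) x = iter n f x.
Proof.
move=> fab xab; elim: n => //= n ->; rewrite clamp_id//.
by elim: n => //= n; exact: fab.
Qed.

End Clamp.

Theorem theorem1p5 (R : realType) (a b : R) (hab : a <= b) (f : R -> R)
    (f_maps : forall x : R, `[a, b]%classic x -> `[a, b]%classic (f x))
    (f_cont : {within `[a, b]%classic, continuous f}) :
  (approximate_product_property `[a, b]%classic f /\
   topological_entropy `[a, b]%classic f = 0%E)
  <->
  (exists p : R, [/\ `[a, b]%classic p, f p = p &
     forall x : R, `[a, b]%classic x -> iter n f x @[n --> \oo] --> p]).
Proof.
have itvE x : `[a, b]%classic x = (a <= x <= b) by rewrite /= in_itv.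
have fab x : a <= x <= b -> a <= f x <= b by have := f_maps x; rewrite !itvE.
pose g := f \o clamp a b.
have g_cont : continuous g by exact: continuous_clamp.
have g_itv x : a <= g x <= b by apply: fab; exact: clamp_itv.
have gE n x : a <= x <= b -> iter n g x = iter n f x by exact: iter_clamp.
have gE1 x : a <= x <= b -> g x = f x by exact: (gE 1%N).
have unif p : a <= p <= b -> f p = p ->
    (forall q, a <= q <= b -> f (f q) = q -> q = p) -> forall e : R, 0 < e ->
    exists N, forall n, (N <= n)%N -> forall x, `[a, b]%classic x ->
      `|iter n f x - p| < e.
  move=> pab fp f2 e e0.
  have [|q qab|N hN] := uniform_cvg_of_square_fixed hab g_itv g_cont pab _ _ e0.
  - by rewrite gE1.
  - by rewrite !gE1 ?fab//; exact: f2.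
  - exists N => n Nn x; rewrite itvE => xab.
    by rewrite -gE//; exact: hN.
split=> [[app ent]|[p [pab fp p_lim]]].
  have [p pab gp] := fixed_point_between hab g_cont
    (andP (g_itv a)).1 (andP (g_itv b)).2.
  have fp : f p = p by rewrite -gE1.
  (* Another point fixed by [f o f] would make the entropy positive. *)
  have f2 q : a <= q <= b -> f (f q) = q -> q = p.
    move=> qab ffq; apply: contrapT => qp.
    have := @topological_entropy_gt0 _ `[a, b]%classic f p q app.
    by rewrite !itvE ent ltxx => /(_ pab qab fp ffq qp).
  exists p; split=> [||x xab]; [by rewrite itvE|by []|].
  apply/cvgrPdist_lt => e e0; have [N hN] := unif p pab fp f2 e e0.
  by exists N => // n /= Nn; rewrite distrC; exact: hN.
have f2 q : a <= q <= b -> f (f q) = q -> q = p.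
  move=> qab ffq.
  have := p_lim q; rewrite itvE => /(_ qab) q_lim.
  (* The even iterates of [q] all equal [q], yet form a subsequence of an orbit tending to [p]. *)
  have : (iter n.*2 f q) @[n --> \oo] --> p.
    apply: cvg_comp q_lim; apply/cvgnyPge => A; exists A => // n /= An.
    by apply: leq_trans An _; rewrite -addnn leq_addr.
  under eq_fun do rewrite iter_period2// odd_double.
  move=> q_cst; apply: (cvg_unique _ _ q_cst) => //; exact: cvg_cst.
have p_unif : forall e : R, 0 < e -> exists N, forall n, (N <= n)%N ->
    forall x, `[a, b]%classic x -> `|iter n f x - p| < e.
  by apply: unif; rewrite -?itvE.
split; first exact: approximate_product_property_uniform pab p_unif fp.
apply: (topological_entropy_uniform pab p_unif); first exact: segment_compact.
move=> n x; rewrite itvE => xab e e0.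
have /cvgrPdist_lt/(_ e e0) := @continuous_iter _ g n g_cont x.
case/nbhs_ballP => d /= d0 hd; exists d => // y /=; rewrite in_itv /= => yab yx.
rewrite -!gE// distrC; apply: hd.
by rewrite /ball /= distrC.
Qed.
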